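(* Let $m,d\geq 1$ be integers and let $f:[0,4]\to\mathbb{R}$ be continuous on $[0,4]$ and $(2m-2)$ times differentiable on $(0,4)$ (differentiable on $(0,4)$ in any case), with $f^{(2m-2)}$ convex on $(0,4)$. Let $\omega_N=\{\mathbf{x}_1,\ldots,\mathbf{x}_N\}\subset S^d$ be an antipodal $m$-sharp configuration. Then the potential $$p_f(\mathbf{x},\omega_N)=\sum_{i=1}^N f(|\mathbf{x}-\mathbf{x}_i|^2),\qquad \mathbf{x}\in S^d,$$ attains its absolute maximum over $S^d$ at every point of $\omega_N$. If moreover $f^{(2m-2)}$ is strictly convex on $(0,4)$, then every point of $S^d$ at which $p_f(\cdot,\omega_N)$ attains its absolute maximum over $S^d$ belongs to $\omega_N$.
   Context: $S^d=\{\mathbf{x}\in\mathbb{R}^{d+1}:|\mathbf{x}|=1\}$, with $|\cdot|$ the Euclidean norm; $\sigma_d$ is the normalized (probability) surface area measure on $S^d$. A finite configuration $\omega_N=\{\mathbf{x}_1,\dots,\mathbf{x}_N\}\subset S^d$ is a spherical $n$-design if $\frac1N\sum_{i=1}^N p(\mathbf{x}_i)=\int_{S^d}p\,d\sigma_d$ for every polynomial $p$ on $\mathbb{R}^{d+1}$ of degree at most $n$. A configuration of $N$ distinct points $\omega_N\subset S^d$ is $m$-sharp if it is a spherical $(2m-1)$-design and exactly $m$ distinct values occur as dot products $\mathbf{x}\cdot\mathbf{y}$ of distinct points $\mathbf{x},\mathbf{y}\in\omega_N$. A configuration is antipodal if $-\mathbf{x}\in\omega_N$ whenever $\mathbf{x}\in\omega_N$.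 Here $f^{(0)}=f$. *)

(* Defs.v *)
From HB Require Import structures.
From mathcomp Require Import all_boot all_order all_algebra.
From mathcomp Require Import all_classical all_reals all_analysis.
From mathcomp Require mpoly.

Set Implicit Arguments.
Unset Strict Implicit.
Unset Printing Implicit Defensive.

Import Order.TTheory GRing.Theory Num.Theory.
Import numFieldNormedType.Exports.
Local Open Scope classical_set_scope.
Local Open Scope ring_scope.

Section Sphere.
Variable R : realType.

Definition dotp (n : nat) (x y : 'rV[R]_n) : R := \sum_(i < n) x 0 i * y 0 i.

Definition sqdist (n : nat) (x y : 'rV[R]_n) : R := dotp (x - y) (x - y).

Definition on_sphere (d : nat) (x : 'rV[R]_d.+1) : Prop := dotp x x = 1.

(* weight of the slice decomposition of S^{d+1} along the first coordinate:
   (1 - t^2)^((d-1)/2) *)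
Definition slice_weight (d : nat) (t : R) : R :=
  powR (1 - t ^+ 2) ((d%:R - 1) / 2).

Definition slice_pt (d : nat) (t : R) (y : 'rV[R]_d.+1) : 'rV[R]_d.+2 :=
  \row_(i < d.+2) (if unlift ord0 i is Some j then Num.sqrt (1 - t ^+ 2) * y 0 j
                   else t).

(* Integral over S^d with respect to the normalized surface (probability)
   measure sigma_d, defined by the classical slice formula
     int_{S^{d+1}} g dsigma_{d+1}
       = (int_{-1}^{1} w_d(t) int_{S^d} g(t, sqrt(1-t^2) y) dsigma_d(y) dt)
         / int_{-1}^{1} w_d(t) dt,
   with sigma_0 the uniform probability on S^0 = {-1, 1}. *)
Fixpoint sphere_int (d : nat) : ('rV[R]_d.+1 -> R) -> R :=
  match d return ('rV[R]_d.+1 -> R) -> R with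
  | 0 => fun g => (g (const_mx 1) + g (const_mx (-1))) / 2
  | d'.+1 => fun g =>
      Rintegral lebesgue_measure [set t : R | -1 <= t <= 1]
        (fun t => slice_weight d' t * sphere_int (fun y => g (slice_pt t y)))
      / Rintegral lebesgue_measure [set t : R | -1 <= t <= 1] (slice_weight d')
  end.

Definition poly_eval (d : nat) (p : mpoly.mpoly d.+1 R) (x : 'rV[R]_d.+1) : R :=
  mpoly.meval (fun i => x 0 i) p.

Definition poly_deg_le (d : nat) (p : mpoly.mpoly d.+1 R) (n : nat) : Prop :=
  all (fun mm : mpoly.multinom d.+1 => (mpoly.mdeg mm <= n)%N) (mpoly.msupp p).

Definition configuration (d N : nat) (x : 'I_N -> 'rV[R]_d.+1) : Prop :=
  injective x /\ forall i, on_sphere (x i).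

Definition spherical_design (d N : nat) (x : 'I_N -> 'rV[R]_d.+1) (n : nat) : Prop :=
  forall p : mpoly.mpoly d.+1 R, poly_deg_le p n ->
    (N%:R)^-1 * \sum_(i < N) poly_eval p (x i) = sphere_int (poly_eval p).

Definition m_sharp (d N m : nat) (x : 'I_N -> 'rV[R]_d.+1) : Prop :=
  configuration x /\ spherical_design x (2 * m - 1) /\
  exists s : seq R, uniq s /\ size s = m /\
    forall a, (a \in s) <-> exists i j : 'I_N, i <> j /\ dotp (x i) (x j) = a.

Definition antipodal (d N : nat) (x : 'I_N -> 'rV[R]_d.+1) : Prop :=
  forall i, exists j, x j = - x i.

Definition potential (d N : nat) (f : R -> R) (x : 'I_N -> 'rV[R]_d.+1)
  (y : 'rV[R]_d.+1) : R := \sum_(i < N) f (sqdist y (x i)).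

Definition open04 : set R := [set t | 0 < t < 4].

Definition convex_on (D : set R) (g : R -> R) : Prop :=
  forall a b t, D a -> D b -> 0 <= t <= 1 ->
    g (t * a + (1 - t) * b) <= t * g a + (1 - t) * g b.

Definition strictly_convex_on (D : set R) (g : R -> R) : Prop :=
  forall a b t, D a -> D b -> a != b -> 0 < t < 1 ->
    g (t * a + (1 - t) * b) < t * g a + (1 - t) * g b.

End Sphere.
Arguments open04 {R}.

(* Main.v *)
(** With g = f(2 - 2 .) on [-1, 1], the potential at y is the sum of g(y . x_i).
    Let h be the Hermite interpolant of f of degree at most 2m - 1 with simple
    nodes at the squared distances 0 and 4 and double nodes at the m - 1 others.
    Convexity of f^(2m-2) and a Rolle count give f <= h on [0, 4].  Since the
    integral over the sphere of a zonal function h(|y - .|^2) does not depend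
    on y, the design property makes the sum of h(|y - x_i|^2) a constant, which
    is the value of the potential at each x_j.

    Under strict convexity f = h only at the nodes.  A maximum point y outside
    the (antipodal) configuration would have all its squared distances among
    the double nodes, so that the polynomial prod (X - tau)^2 of degree 2m - 2
    would sum to 0 at y, but not at x_j: this contradicts the same constancy.

    The zonal invariance is obtained from the slice formula by induction on the
    dimension: the moments of t^n (1 - t^2)^s on [-1, 1] satisfy the recursion
    n I(n-1, s+1) = 2 (s+1) I(n+1, s), and a binomial identity then recombines
    the slices into a power of |y|^2. *)
Require Import Defs.
From HB Require Import structures.
From mathcomp Require Import all_boot all_order all_algebra.
From mathcomp Require Import all_classical all_reals all_analysis.
From mathcomp Require mpoly.
From mathcomp Require Import measurable_realfun zify ring lra.
Import Order.TTheory GRing.Theory Num.Theory.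
Import numFieldNormedType.Exports.
Import (canonicals) mpoly.
Local Open Scope classical_set_scope.
Local Open Scope ring_scope.

Set Implicit Arguments.
Unset Strict Implicit.
Unset Printing Implicit Defensive.

(** * The Jacobi weight and its moments *)

(** The absolute value keeps the base nonnegative, so continuity holds on the whole line; at 0 the
    ball of radius [e] to the power [1/p] is mapped into the ball of radius [e]. *)
Lemma continuous_norm_powR {R : realType} (p : R) : 0 < p ->
  continuous (fun u : R => `|u| `^ p).
Proof.
move=> p0 u; have [->|u0] := eqVneq u 0; last first.
  change (continuous_at u ((fun v : R => v `^ p) \o (fun v : R => `|v|))).
  apply: continuous_comp; first exact: norm_continuous.
  apply: differentiable_continuous; apply/derivable1_diffP.
  by apply: derivable_powR; rewrite in_itv/= andbT normr_gt0.
rewrite /continuous_at normr0 powR0 ?gt_eqF//.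
apply/cvgr0Pnorm_lt => e e0; near=> v.
rewrite (ger0_norm (powR_ge0 _ _)).
have -> : e = (e `^ p^-1) `^ p by rewrite -powRrM mulVf ?gt_eqF// powRr1// ltW.
rewrite gt0_ltr_powR ?nnegrE ?powR_ge0//.
near: v; exists (e `^ p^-1); first exact: powR_gt0.
by move=> z /=; rewrite sub0r normrN.
Unshelve. all: by end_near. Qed.

(* The integrand may be unbounded near the endpoints. *)
Lemma Rintegral_FTC2_open {R : realType} (a b : R) (f F : R -> R) : a < b ->
  (@lebesgue_measure R).-integrable `[a, b] (EFin \o f) ->
  {within `[a, b], continuous F} ->
  (forall t, a < t < b -> {for t, continuous f}) ->
  (forall t, a < t < b -> is_derive t 1 F (f t)) ->
  \int[lebesgue_measure]_(t in `[a, b]) f t = F b - F a.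
Proof.
move=> ab fi cF cf dF.
(* [G - F] is continuous on the closed interval with derivative 0 inside, so the mean value theorem
   equates its values at [a] and [b], and [G a = 0]. *)
pose G x := \int[lebesgue_measure]_(t in `[a, x]) f t.
have dG x : a < x < b -> is_derive x 1 G (f x).
  move=> xab; have /andP[ax xb] := xab.
  have [dx <-] := @continuous_FTC1_closed _ _ a x b xb fi ax (cf x xab).
  by rewrite derive1E; exact: derivableP.
have dD x : x \in `]a, b[%R -> is_derive x 1 (G - F) ((cst 0 : R -> R) x).
  rewrite in_itv/= => xab; have ? := dG x xab; have ? := dF x xab.
  by apply: is_derive_eq; rewrite subrr.
have cD : {within `[a, b], continuous (G - F)}.
  move=> x; apply: continuousB; last exact: cF.
  exact: (parameterized_integral_continuous (ltW ab) fi).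
have [c _] := MVT ab dD cD.
rewrite mul0r => /eqP; rewrite subr_eq0 => /eqP.
rewrite !fctE => GF.
have Ga : G a = 0 by rewrite /G set_itv1 Rintegral_set1.
rewrite Ga in GF; change (G b = F b - F a); lra.
Qed.

Section JacobiWeight.
Context {R : realType}.
Implicit Types (s t r : R) (n : nat).

Let mu := @lebesgue_measure R.

Definition jacobi s t : R := (1 - t ^+ 2) `^ s.

Lemma jacobi_ge0 s t : 0 <= jacobi s t.
Proof. exact: powR_ge0. Qed.

Lemma oneBsqr_gt0 t : -1 < t < 1 -> 0 < 1 - t ^+ 2.
Proof. by move=> /andP[? ?]; nra. Qed.

Lemma oneBsqr_ge0 t : -1 <= t <= 1 -> 0 <= 1 - t ^+ 2.
Proof. by move=> /andP[? ?]; nra. Qed.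

Lemma jacobiS s t : -1 < t < 1 -> jacobi (s + 1) t = (1 - t ^+ 2) * jacobi s t.
Proof.
move=> /oneBsqr_gt0 t1; rewrite /jacobi powRD; last by rewrite (gt_eqF t1) implybT.
by rewrite powRr1 1?mulrC// ltW.
Qed.

Lemma jacobi_derive s t : -1 < t < 1 ->
  is_derive t 1 (jacobi (s + 1)) (- 2 * (s + 1) * t * jacobi s t).
Proof.
move=> /oneBsqr_gt0 t1.
have d1 : is_derive t 1 (fun t : R => 1 - t ^+ 2) (- 2 * t).
  by apply: is_derive_eq; rewrite /GRing.scale/=; ring.
have d2 := @is_derive1_powR _ (s + 1) _ t1.
have := @is_derive1_comp _ (fun u : R => u `^ (s + 1)) (fun t : R => 1 - t ^+ 2)
  t _ _ d2 d1.
by move=> h; apply: (is_derive_eq h); rewrite addrK /jacobi; ring.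
Qed.

Lemma jacobi_continuous s t : -1 < t < 1 -> {for t, continuous (jacobi s)}.
Proof.
move=> t1; apply: differentiable_continuous; apply/derivable1_diffP.
by have := jacobi_derive (s - 1) t1; rewrite subrK => -[].
Qed.

Lemma jacobi_continuous_within s : 0 < s ->
  {within `[-1, 1], continuous (jacobi s)}.
Proof.
move=> s0; apply: (@subspace_eq_continuous _ _ _ (fun t => `|1 - t ^+ 2| `^ s)).
  move=> t; rewrite inE/= in_itv/= => /oneBsqr_ge0 t1.
  by rewrite /jacobi ger0_norm.
apply: continuous_subspaceT => t.
change (continuous_at t ((fun u : R => `|u| `^ s) \o (fun t : R => 1 - t ^+ 2))).
apply: continuous_comp.
  apply: continuousB; first exact: cst_continuous.
  exact: exprn_continuous.
exact: continuous_norm_powR.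
Qed.

Lemma measurable_jacobi s (D : set R) : measurable D -> measurable_fun D (jacobi s).
Proof.
move=> mD.
change (measurable_fun D ((fun u : R => u `^ s) \o (fun t : R => 1 - t ^+ 2))).
apply: measurableT_comp; first exact: measurable_powR.
by apply: measurable_funB => //; apply: measurable_funX.
Qed.

Lemma jacobi_le1 s t : 0 <= s -> -1 <= t <= 1 -> jacobi s t <= 1.
Proof.
move=> s0 t1; have := oneBsqr_ge0 t1 => u0.
have e : (1 : R) `^ s = 1 by rewrite powR1.
by rewrite -[leRHS]e ge0_ler_powR// ?nnegrE// lerBlDr lerDl sqr_ge0.
Qed.

Lemma mem_segment r t : 0 < r < 1 -> -r <= t <= r -> -1 < t < 1.
Proof. by move=> /andP[? ?] /andP[? ?]; apply/andP; split; lra. Qed.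

Lemma Xn_jacobi_integrable_segment n s r : 0 < r < 1 ->
  mu.-integrable `[-r, r] (EFin \o (fun t => t ^+ n * jacobi s t)).
Proof.
move=> r01; apply: continuous_compact_integrable; first exact: segment_compact.
apply: continuous_in_subspaceT => t; rewrite inE/= in_itv/= => /(mem_segment r01) t1.
exact: (continuousM (@exprn_continuous _ n t) (@jacobi_continuous s t t1)).
Qed.

Lemma jacobi_integrable_segment s r : 0 < r < 1 ->
  mu.-integrable `[-r, r] (EFin \o jacobi s).
Proof.
move=> /(Xn_jacobi_integrable_segment 0 s); apply: eq_integrable => // t _.
by rewrite /= expr0 mul1r.
Qed.

Lemma segment_subset1 r : 0 < r < 1 -> `[-r, r] `<=` `[-1, 1].
Proof.
move=> /andP[? ?] t /=; rewrite !in_itv/= => /andP[? ?].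
by apply/andP; split; lra.
Qed.

(** Product rule, in the form whose integral gives the moment recursion. For [n = 0] the truncated
    [n.-1] is harmless, since its coefficient is 0. *)
Lemma deriv_Xn_jacobi n s t : -1 < t < 1 ->
  is_derive t 1 (fun t => t ^+ n * jacobi (s + 1) t)
    (n%:R * (t ^+ n.-1 * jacobi (s + 1) t) -
     2 * (s + 1) * (t ^+ n.+1 * jacobi s t)).
Proof.
move=> t1; have := jacobi_derive s t1 => ?.
have ? : is_derive t 1 (fun t : R => t ^+ n) (n%:R * t ^+ n.-1).
  apply: DeriveDef; first exact: exprn_derivable.
  by rewrite exp_derive /GRing.scale/= mulr1.
apply: (@is_derive_eq _ _ _ ((fun t : R => t ^+ n) * jacobi (s + 1))).
by rewrite /GRing.scale/= exprS; ring.
Qed.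

Lemma continuous_Xn_jacobi n s : -1 < s ->
  {within `[-1, 1], continuous (fun t => t ^+ n * jacobi (s + 1) t)}.
Proof.
move=> s1.
have c1 : {within `[-1, 1], continuous (fun t : R => t ^+ n)}.
  by apply: continuous_subspaceT => u; exact: exprn_continuous.
have c2 : {within `[-1, 1], continuous (jacobi (s + 1))}.
  by apply: jacobi_continuous_within; lra.
by move=> t; exact: (continuousM (c1 t) (c2 t)).
Qed.

(* By parts on [-r, r]: the integral of (1 - t^2)^s is bounded uniformly in r < 1. *)
Lemma jacobi_integrable s : -1 < s -> mu.-integrable `[-1, 1] (EFin \o jacobi s).
Proof.
move=> s1.
(* [I0], [I1], [I2] stand for the integrals over [-r, r] of (1-t^2)^s, (1-t^2)^(s+1) and t^2
   (1-t^2)^s. The last premise bounds [I2] by [I1 / (2 (s + 1))], hence by [1 / (s + 1)]. *)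
have key (I0 I1 I2 : R) : I0 = I1 + I2 -> I1 <= 2 ->
    0 <= I1 - 2 * (s + 1) * I2 -> I0 <= 2 + (s + 1)^-1.
  move=> -> I1le I2le; have s10 : 0 < s + 1 by lra.
  have : I2 <= (s + 1)^-1 by rewrite -[leRHS]mul1r ler_pdivlMr//; lra.
  lra.
have bnd r : 0 < r < 1 ->
    (\int[mu]_(t in `[(- r)%R, r]) (jacobi s t)%:E <= (2 + (s + 1)^-1)%:E)%E.
  move=> r01; have /andP[r0 r1] := r01.
  have i0 := jacobi_integrable_segment s r01.
  have i1 := jacobi_integrable_segment (s + 1) r01.
  have i2 := Xn_jacobi_integrable_segment 2 s r01.
  rewrite -[leLHS]fineK; last exact: integrable_fin_num.
  rewrite lee_fin -/(Rintegral mu `[-r, r] (jacobi s)).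
  have i3 : mu.-integrable `[-r, r]
      (EFin \o (fun t => 2 * (s + 1) * (t ^+ 2 * jacobi s t))).
    exact: (integrableZl _ _ i2).
  have e2 : \int[mu]_(t in `[-r, r]) jacobi s t =
    \int[mu]_(t in `[-r, r]) jacobi (s + 1) t +
    \int[mu]_(t in `[-r, r]) (t ^+ 2 * jacobi s t).
    rewrite -RintegralD//; apply: eq_Rintegral => t.
    rewrite inE/= in_itv/= => /(mem_segment r01) t1.
    by rewrite jacobiS//; ring.
  have e3 : \int[mu]_(t in `[-r, r]) jacobi (s + 1) t <= 2.
    have ic : mu.-integrable `[-r, r] (EFin \o cst 1).
      apply: continuous_compact_integrable; first exact: segment_compact.
      by apply: continuous_subspaceT => t; exact: cst_continuous.
    rewrite (@le_trans _ _ (\int[mu]_(t in `[-r, r]) 1))//; last first.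
      have -> : \int[mu]_(t in `[-r, r]) 1 = 1 * fine (mu `[-r, r]) by exact: Rintegral_cst.
      have -> : mu `[-r, r] = (r + r)%:E.
        by rewrite [LHS]lebesgue_measure_itv/= lte_fin gtrN// -EFinB opprK.
      rewrite /= mul1r; lra.
    apply: le_Rintegral => //.
    move=> t /=; rewrite in_itv/= => /(mem_segment r01)/andP[? ?].
    apply: jacobi_le1; first lra.
    by apply/andP; split; lra.
  have e4 : 0 <= \int[mu]_(t in `[-r, r]) jacobi (s + 1) t
                - 2 * (s + 1) * \int[mu]_(t in `[-r, r]) (t ^+ 2 * jacobi s t).
    rewrite -RintegralZl// -RintegralB//.
    (* The integrand is the derivative of t (1-t^2)^(s+1), and the boundary terms at r and -r add up
       to a nonnegative number. *)
    have -> : \int[mu]_(t in `[-r, r])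
              (jacobi (s + 1) t - 2 * (s + 1) * (t ^+ 2 * jacobi s t)) = r ^+ 1 * jacobi (s + 1) r - (- r) ^+ 1 * jacobi (s + 1) (- r).
      apply: (@Rintegral_FTC2_open _ _ _ _ (fun t => t ^+ 1 * jacobi (s + 1) t)).
      - by rewrite gtrN.
      - exact: (integrableB _ i1 i3).
      - exact: (continuous_subspaceW (@segment_subset1 r r01) (@continuous_Xn_jacobi 1 s s1)).
      - move=> t /andP[rt tr].
        have t1 : -1 < t < 1 by apply: (mem_segment r01); rewrite !ltW.
        apply: continuousB; first exact: jacobi_continuous.
        apply: continuousM; first exact: cst_continuous.
        exact: (continuousM (@exprn_continuous _ 2 t) (@jacobi_continuous s t t1)).
      - move=> t /andP[rt tr].
        have t1 : -1 < t < 1 by apply: (mem_segment r01); rewrite !ltW.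
        by apply: is_derive_eq (deriv_Xn_jacobi 1 s t1) _; rewrite expr0 !mul1r.
    by rewrite /jacobi sqrrN !expr1 mulNr opprK addr_ge0// mulr_ge0 ?powR_ge0// ltW.
  exact: key e2 e3 e4.
apply/integrableP; split.
  by apply/measurable_EFinP; exact: measurable_jacobi.
under eq_integral do rewrite /= ger0_norm ?jacobi_ge0//.
rewrite -integral_itv_obnd_cbnd -?integral_itv_bndo_bndc; last 2 first.
  by apply/measurable_EFinP; exact: measurable_jacobi.
  by apply/measurable_EFinP; exact: measurable_jacobi.
(* The null endpoints have been dropped; the segments [[- rk k, rk k]] exhaust the open interval,
   and monotone convergence carries the uniform bound to the limit. The shift by 2 makes [rk 0]
   positive. *)
pose rk k : R := 1 - (k.+2)%:R^-1.
have rk01 k : 0 < rk k < 1.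
  rewrite /rk subr_gt0 invf_lt1 ?ltr1n// gtrBl invr_gt0. exact: ltr0Sn.
pose D k := `[- rk k, rk k]%classic.
have -> : `]-1, 1[%classic = \bigcup_k D k.
  apply/seteqP; split => t /=; rewrite in_itv/=; last first.
    by move=> [k _]; rewrite /D/= in_itv/=; exact: mem_segment.
  move=> t1; have n1 : `|t| < 1 by rewrite ltr_norml.
  have p1 : 0 <= (1 - `|t|)^-1 by rewrite invr_ge0 subr_ge0 ltW.
  exists (Num.bound (1 - `|t|)^-1) => //; rewrite /D/= in_itv/= -ler_norml /rk.
  rewrite lerBrDr -lerBrDl.
  rewrite -[leRHS]invrK lef_pV2 ?posrE ?invr_gt0 ?subr_gt0//.
  rewrite (le_trans (ltW (archi_boundP p1)))// ler_nat; exact/leqW/leqnSn.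
have nD : nondecreasing_seq D.
  move=> k l kl; apply/subsetPset => t; rewrite /D/= !in_itv/= -!ler_norml.
  by move=> /le_trans; apply; rewrite /rk lerD2l lerN2 lef_pV2 ?posrE// ler_nat !ltnS.
have h1 i : measurable (D i) by exact: measurable_itv.
have h2 i : measurable_fun (D i) (EFin \o jacobi s).
  by apply/measurable_EFinP; exact: measurable_jacobi.
have h3 i u : D i u -> (0 <= (EFin \o jacobi s) u)%E by rewrite /= lee_fin jacobi_ge0.
have cv := ge0_nondecreasing_set_cvg_integral (mu := mu) nD h1 h2 h3.
rewrite -(cvg_lim _ cv)//.
apply: (@le_lt_trans _ _ (2 + (s + 1)^-1)%:E); last exact: ltry.
apply: lime_le; first by apply/cvg_ex; eexists; exact: cv.
by apply: nearW => k; exact: bnd.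
Qed.
End JacobiWeight.

(** * Moments of the Jacobi weight and of one coordinate on the sphere *)

Section JacobiMoments.
Context {R : realType}.
Implicit Types (s t : R) (n : nat).

Let mu := @lebesgue_measure R.

Lemma Xn_jacobi_integrable n s : -1 < s ->
  mu.-integrable `[-1, 1] (EFin \o (fun t => t ^+ n * jacobi s t)).
Proof.
move=> s1; apply: le_integrable (jacobi_integrable s1) => //.
  apply/measurable_EFinP; apply: measurable_funM; last exact: measurable_jacobi.
  exact: measurable_funX.
move=> t /=; rewrite in_itv/= => t1; rewrite lee_fin normrM normrX.
rewrite ler_piMl// exprn_ile1//.
by rewrite ler_norml.
Qed.

Definition jmom n s := \int[mu]_(t in `[-1, 1]) (t ^+ n * jacobi s t).

Lemma jacobi_addn s i t : -1 < s -> -1 <= t <= 1 ->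
  jacobi (s + i%:R) t = (1 - t ^+ 2) ^+ i * jacobi s t.
Proof.
move=> s1 t1; elim: i => [|i IHi]; first by rewrite addr0 mul1r.
have si0 : 0 <= i%:R :> R by [].
(* At the endpoints the base is 0 and both sides vanish, the exponent [s + i + 1] being nonzero
   because [s > -1]. *)
have := oneBsqr_ge0 t1; rewrite le_eqVlt => /predU1P[t0|t0].
  by rewrite /jacobi -t0 powR0 ?exprS ?mul0r// -natr1; apply: lt0r_neq0; lra.
have t1' : -1 < t < 1 by case/andP: t1 => ? ?; apply/andP; split; nra.
by rewrite exprS -mulrA -IHi -natr1 addrA jacobiS.
Qed.

(** The two sides differ by the integral of the derivative of [t ^+ n * jacobi (s + 1) t], which
    vanishes at both endpoints since [s + 1 > 0]. *)
Lemma jmom_recl n s : -1 < s ->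
  n%:R * jmom n.-1 (s + 1) = 2 * (s + 1) * jmom n.+1 s.
Proof.
move=> s1; have s2 : -1 < s + 1 by lra.
have i1 := Xn_jacobi_integrable n.-1 s2.
have i2 := Xn_jacobi_integrable n.+1 s1.
apply/eqP; rewrite -subr_eq0; apply/eqP.
rewrite /jmom -!RintegralZl// -RintegralB//;
  [|exact: (integrableZl _ _ i1)|exact: (integrableZl _ _ i2)].
have -> : 0 = 1 ^+ n * jacobi (s + 1) 1 - (- 1) ^+ n * jacobi (s + 1) (- 1) :> R.
  rewrite /jacobi sqrrN !expr1n subrr powR0 ?mulr0 ?subrr//.
  by apply: lt0r_neq0; lra.
apply: (@Rintegral_FTC2_open _ _ _ _ (fun t => t ^+ n * jacobi (s + 1) t)).
- by rewrite gtrN.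
- exact: (integrableB _ (integrableZl _ _ i1) (integrableZl _ _ i2)).
- exact: continuous_Xn_jacobi.
- move=> t t1; apply: continuousB.
    apply: continuousM; first exact: cst_continuous.
    exact: (continuousM (@exprn_continuous _ _ t) (@jacobi_continuous _ _ t t1)).
  apply: continuousM; first exact: cst_continuous.
  exact: (continuousM (@exprn_continuous _ _ t) (@jacobi_continuous _ _ t t1)).
- by move=> t t1; exact: deriv_Xn_jacobi.
Qed.

(** The recursion [jmom_recl] lowers the exponent by 2 while raising [s] by 1, down to exponent 1,
    where its left side has coefficient 0. *)
Lemma jmom_odd n s : -1 < s -> odd n -> jmom n s = 0.
Proof.
elim/ltn_ind: n s => -[//|[|n]] IHn s s1 n_odd.
all: have := jmom_recl _ s1.
  move=> /(_ 0); rewrite mul0r => /esym/eqP; rewrite mulf_eq0 => /orP[|/eqP//].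
  by rewrite gt_eqF//; lra.
move=> /(_ n.+1)/=; rewrite IHn//; last 2 first.
- lra.
- by move: n_odd; rewrite /= negbK.
rewrite mulr0 => /esym/eqP; rewrite mulf_eq0 => /orP[|/eqP//].
by rewrite gt_eqF//; lra.
Qed.

(** Writing 1 = (1-t^2) + t^2 splits [jmom n s] into [jmom n (s + 1) + jmom n.+2 s]; then
    [jmom_recl] eliminates the first term. *)
Lemma jmomSS n s : -1 < s ->
  (2 * (s + 1) + n.+1%:R) * jmom n.+2 s = n.+1%:R * jmom n s.
Proof.
move=> s1; rewrite [LHS]mulrDl; have /= <- := jmom_recl n.+1 s1.
rewrite -mulrDr; congr (_ * _).
have i0 := Xn_jacobi_integrable n s1.
have s2 : -1 < s + 1 by lra.
rewrite /jmom -RintegralD//; [|exact: Xn_jacobi_integrable..].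
apply: eq_Rintegral => t; rewrite inE/= in_itv/= => t1.
by have := jacobi_addn 1 s1 t1; rewrite /= => ->; rewrite expr1 !exprS; ring.
Qed.

(* The k-th moment of one coordinate of a uniform point of S^d. *)
Fixpoint sphere_mom (d k : nat) : R :=
  match k with
  | 0 => 1 | 1 => 0
  | j.+2 => j.+1%:R / (d + j.+1)%:R * sphere_mom d j
  end.

Lemma sphere_mom_odd d k : odd k -> sphere_mom d k = 0.
Proof.
elim/ltn_ind: k => -[//|[//|k]] IHk /= k_odd.
by rewrite IHk ?mulr0//; rewrite negbK in k_odd.
Qed.

(** The exponent in [slice_weight d]. For [d = 0], the slicing of the circle, it is -1/2 and the
    weight is unbounded at the endpoints. *)
Definition slice_exp d : R := (d%:R - 1) / 2.

Lemma slice_exp_gt d : -1 < slice_exp d.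
Proof. by rewrite /slice_exp; have : 0 <= d%:R :> R by []; lra. Qed.

(** Both sides obey the same two-step recursion: in [jmomSS] the factor 2 (s+1) + 2k+1 becomes (d+1)
    + (2k+1) when s = (d-1)/2. *)
Lemma jmom_slice d k :
  jmom k.*2 (slice_exp d) = jmom 0 (slice_exp d) * sphere_mom d.+1 k.*2.
Proof.
elim: k => [|k IHk]; first by rewrite mulr1.
have := jmomSS k.*2 (slice_exp_gt d); rewrite doubleS /= IHk => e.
have dk : (d.+1 + k.*2.+1)%:R != 0 :> R by rewrite pnatr_eq0.
apply: (mulfI dk); move: dk.
have -> : (d.+1 + k.*2.+1)%:R = 2 * (slice_exp d + 1) + k.*2.+1%:R :> R.
  by rewrite natrD -natr1 /slice_exp; field.
move=> dk; rewrite e; move: dk; set D := (2 * _ + _) => dk.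
by field.
Qed.

(** Induction on [i] for all [a]: the case [(a, i + 1)] reduces to [(a + 1, i)], with the same sum,
    by the recursions of [sphere_mom] and [jmom] and the ratios of neighbouring binomials. *)
Lemma jmom_slice_bin d a i :
  'C((a + i).*2, i.*2)%:R * (sphere_mom d i.*2 * jmom a.*2 (slice_exp d + i%:R)) =
  'C(a + i, i)%:R * (jmom 0 (slice_exp d) * sphere_mom d.+1 (a + i).*2) :> R.
Proof.
elim: i a => [|i IHi] a.
  by rewrite addn0 !bin0 addr0 !mul1r jmom_slice.
(* The field computation of the inductive step. With n = 2(a+i+1), [B0], [B1], [B2] are the
   binomials of n at 2i, 2i+1, 2i+2; [C], [C'] those of a+i+1 at i, i+1; [D] is d+2i+1; [J] and [J']
   are the two moments linked by [jmom_recl]. *)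
have alg (A I B0 B1 B2 C C' D m J J' Z : R) : 0 <= A -> 0 <= I -> 0 < D ->
    (I + 1) * C' = (A + 1) * C -> (2 * I + 2) * B2 = (2 * A + 1) * B1 ->
    (2 * I + 1) * B1 = (2 * A + 2) * B0 -> (2 * A + 1) * J = D * J' ->
    B0 * (m * J') = C * Z -> B2 * ((2 * I + 1) / D * m * J) = C' * Z.
  move=> A0 I0 D0 hC hB2 hB1 hJ hZ.
  have -> : C' = (A + 1) * C / (I + 1) by rewrite -hC; field; lra.
  have -> : B2 = (2 * A + 1) * B1 / (2 * I + 2) by rewrite -hB2; field; lra.
  have -> : B1 = (2 * A + 2) * B0 / (2 * I + 1) by rewrite -hB1; field; lra.
  have -> : J = D * J' / (2 * A + 1) by rewrite -hJ; field; lra.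
  transitivity ((A + 1) / (I + 1) * (B0 * (m * J'))); last by rewrite hZ; field; lra.
  field; by do ?[apply/andP; split]; lra.
have r1 : 2 * a%:R + 1 = a.*2.+1%:R :> R by rewrite -[RHS]natr1 -mul2n natrM.
have r2 : 2 * i%:R + 1 = i.*2.+1%:R :> R by rewrite -[RHS]natr1 -mul2n natrM.
have sl : -1 < slice_exp d + i%:R.
  by have := slice_exp_gt d; have : 0 <= i%:R :> R by []; lra.
have rD : 2 * (slice_exp d + i%:R + 1) = (d + i.*2.+1)%:R.
  by rewrite natrD -r2 /slice_exp; field.
have dN : i.+1%:R = i%:R + 1 :> R by rewrite -natr1.
have dA : a.+1%:R = a%:R + 1 :> R by rewrite -natr1.
have := IHi a.+1; rewrite addSnnS.
rewrite [sphere_mom d i.+1.*2]/= -/(sphere_mom d _) -r2.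
apply: (@alg a%:R i%:R _ 'C((a + i.+1).*2, i.*2.+1)%:R) => //.
- rewrite -dN -dA -!natrM mul_bin_left; congr (_ * _)%:R; lia.
- rewrite r1 -[2 * _ + 2](_ : i.*2.+2%:R = _); last by rewrite -[LHS]natr1 -r2; ring.
  rewrite -!natrM doubleS mul_bin_left; congr (_ * _)%:R; lia.
- rewrite r2 -[2 * _ + 2](_ : a.*2.+2%:R = _); last by rewrite -[LHS]natr1 -r1; ring.
  rewrite -!natrM mul_bin_left; congr (_ * _)%:R; lia.
- have := jmom_recl a.*2.+1 sl; rewrite rD /= -r1 dN addrA doubleS => <-.
  by [].
Qed.
End JacobiMoments.

(** * Zonal polynomials and designs *)

Lemma big_even_odd {V : nmodType} (k : nat) (F : nat -> V) :
  \sum_(j < k.*2.+1) F j = \sum_(i < k.+1) F i.*2 + \sum_(i < k) F i.*2.+1.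
Proof.
elim: k => [|k IHk]; first by rewrite big_ord0 addr0 !big_ord_recl !big_ord0.
rewrite doubleS big_ord_recr big_ord_recr IHk /=.
rewrite [\sum_(i < k.+2) _]big_ord_recr [\sum_(i < k.+1) F i.*2.+1]big_ord_recr /=.
by rewrite doubleS -addrA [F _ + F _]addrC addrACA.
Qed.

Lemma coef_affineX {R : comNzRingType} (a b : R) (k j : nat) :
  ((b *: 'X + a%:P) ^+ k)`_j = 'C(k, j)%:R * (a ^+ (k - j) * b ^+ j).
Proof.
rewrite addrC exprDn coef_sum.
under eq_bigr => i _.
  rewrite exprZn -polyC_exp -scalerAr -mul_polyC mulrA -polyCM coefMn coefCM coefXn.
  rewrite mulr_natr. over.
have [jk|kj] := ltnP j k.+1.
  rewrite (bigD1 (Ordinal jk))//= eqxx big1 ?addr0; last first.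
    by move=> i; rewrite -val_eqE/= eq_sym => /negPf ->; rewrite mulr0n mul0rn.
  by rewrite mulr1n mulrC mulr_natl mulrC.
rewrite bin_small// mul0r big1// => i _.
by rewrite gtn_eqF ?mulr0n ?mul0rn// (leq_trans (ltn_ord i)).
Qed.

(** Both claims go through one induction, since additivity of the integral requires the
    integrability of the tail. *)
Lemma Rintegral_lincomb {R : realType} (D : set R) (I : Type) (r : seq I)
    (c : I -> R) (g : I -> R -> R) : measurable D ->
  (forall i, (@lebesgue_measure R).-integrable D (EFin \o g i)) ->
  (@lebesgue_measure R).-integrable D (EFin \o (fun t => \sum_(i <- r) c i * g i t)) /\
  \int[lebesgue_measure]_(t in D) (\sum_(i <- r) c i * g i t) =
  \sum_(i <- r) c i * \int[lebesgue_measure]_(t in D) g i t.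
Proof.
move=> mD ig; elim: r => [|i r [IH1 IH2]].
  split.
    have : (@lebesgue_measure R).-integrable D (cst 0%E) by exact: integrable0.
    apply: eq_integrable => //= t _.
    by rewrite big_nil.
  rewrite big_nil; under eq_Rintegral do rewrite big_nil.
  by rewrite Rintegral_cst// mul0r.
have i1 : (@lebesgue_measure R).-integrable D (EFin \o (fun t => c i * g i t)).
  exact: (integrableZl _ _ (ig i)).
split.
  have : (@lebesgue_measure R).-integrable D
      ((EFin \o (fun t => c i * g i t)%R) \+
       (EFin \o (fun t => \sum_(i <- r) c i * g i t)%R))%E.
    exact: integrableD.
  apply: eq_integrable => //= t _.
  by rewrite big_cons.
rewrite big_cons -IH2 -RintegralZl// -RintegralD//.
by apply: eq_Rintegral => t _; rewrite big_cons.
Qed.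

Section ZonalIntegral.
Context {R : realType}.
Implicit Types (h : {poly R}) (d : nat).

(** The expected mean of h(y.z) over z in S^d when |y|^2 = rho: y.z is distributed as |y| times a
    coordinate. Odd moments vanish, so |y|^k can be written [rho ^+ k./2] without a square root. *)
Definition zonal_mean d h (rho : R) : R :=
  \sum_(k < size h) h`_k * (sphere_mom d k * rho ^+ k./2).

Lemma zonal_mean_widen d h rho n : (size h <= n)%N ->
  zonal_mean d h rho = \sum_(k < n) h`_k * (sphere_mom d k * rho ^+ k./2).
Proof.
move=> hn; rewrite /zonal_mean.
rewrite (big_ord_widen _ (fun k => h`_k * (sphere_mom d k * rho ^+ k./2)) hn).
rewrite big_mkcond/=; apply: eq_bigr => k _.
by case: ltnP => // kh; rewrite nth_default ?mul0r.
Qed.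

(** On a slice at fixed height the inner product is an affine function of an inner product in one
    dimension less; this expands a polynomial composed with such a function. *)
Lemma zonal_mean_affine d h rho (a b : R) :
  zonal_mean d (h \Po (b *: 'X + a%:P)) rho =
  \sum_(k < size h) h`_k * \sum_(j < k.+1)
    'C(k, j)%:R * (a ^+ (k - j) * b ^+ j) * (sphere_mom d j * rho ^+ j./2).
Proof.
have hs : (size (h \Po (b *: 'X + a%:P))%R <= size h)%N.
  have [->|h0] := eqVneq h 0; first by rewrite comp_poly0.
  apply: leq_trans (size_comp_poly_leq _ _) _.
  have : (size (b *: 'X + a%:P)%R <= 2)%N.
    rewrite (leq_trans (size_polyD _ _))// geq_max.
    rewrite (leq_trans (size_scale_leq _ _)) ?size_polyX//=.
    by rewrite (leq_trans (size_polyC_leq1 _)).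
  by move: (size (b *: 'X + a%:P)%R) => [|[|[|]]]//= _;
    rewrite ?muln0 ?muln1 ?prednK// lt0n size_poly_eq0.
rewrite (zonal_mean_widen _ _ hs).
transitivity (\sum_(j < size h) \sum_(k < size h) h`_k *
    ('C(k, j)%:R * (a ^+ (k - j) * b ^+ j) * (sphere_mom d j * rho ^+ j./2))).
  apply: eq_bigr => j _; rewrite comp_polyE coef_sum mulr_suml; apply: eq_bigr => k _.
  by rewrite coefZ coef_affineX !mulrA.
rewrite exchange_big/=; apply: eq_bigr => k _; rewrite -mulr_sumr; congr (_ * _).
rewrite [RHS](big_ord_widen (size h) (fun j =>
  'C(k, j)%:R * (a ^+ (k - j) * b ^+ j) * (sphere_mom d j * rho ^+ j./2)))//.
rewrite [RHS]big_mkcond/=; apply: eq_bigr => j _.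
by case: ltnP => // kj; rewrite bin_small// !mul0r.
Qed.

(** Here [a] plays the first coordinate of y and [rho] the squared norm of the others. For odd [k]
    each term contains an odd moment, which is 0. For even [k] only even [j] survive, and
    [jmom_slice_bin] matches them with the binomial expansion of (a^2 + rho)^(k/2). *)
Lemma slice_moment d k (a rho : R) :
  \sum_(j < k.+1) 'C(k, j)%:R * (a ^+ (k - j) * (sphere_mom d j * rho ^+ j./2)) *
     jmom (k - j) (slice_exp d + j./2%:R) =
  jmom 0 (slice_exp d) * (sphere_mom d.+1 k * (a ^+ 2 + rho) ^+ k./2).
Proof.
have sgt i : -1 < slice_exp d + i%:R :> R.
  by have := @slice_exp_gt R d; have : 0 <= i%:R :> R by []; lra.
have [k_odd|k_even] := boolP (odd k).
  rewrite sphere_mom_odd// mul0r mulr0 big1// => j _.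
  have [j_odd|j_even] := boolP (odd j).
    by rewrite sphere_mom_odd// mul0r !mulr0 mul0r.
  rewrite jmom_odd ?mulr0//.
  by rewrite oddB ?k_odd ?(negPf j_even)// -ltnS.
rewrite -[k](odd_double_half k) (negPf k_even) add0n; set K := k./2.
rewrite (big_even_odd K (fun j => 'C(K.*2, j)%:R *
  (a ^+ (K.*2 - j) * (sphere_mom d j * rho ^+ j./2)) *
     jmom (K.*2 - j) (slice_exp d + j./2%:R))) [X in _ + X]big1 ?addr0; last first.
  by move=> i _; rewrite sphere_mom_odd ?mul0r ?mulr0 ?mul0r//= odd_double.
rewrite doubleK exprDn !mulr_sumr; apply: eq_bigr => i _.
have iK : (i <= K)%N by rewrite -ltnS.
have := @jmom_slice_bin R d (K - i) i; rewrite subnK// => e.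
rewrite doubleK -doubleB -exprM mul2n.
rewrite -[_ *+ 'C(K, i)]mulr_natl.
transitivity ((a ^+ (K - i).*2 * rho ^+ i) * ('C(K.*2, i.*2)%:R * (sphere_mom d i.*2 *
      jmom (K - i).*2 (slice_exp d + i%:R)))); first by ring.
by rewrite e; ring.
Qed.
End ZonalIntegral.

(** * Sphere integrals of zonal functions and their sums over designs *)

Section SphereZonal.
Context {R : realType}.
Implicit Types (h : {poly R}) (d : nat).

Lemma dotp_slice_pt d (y : 'rV[R]_d.+2) (z : 'rV[R]_d.+1) t :
  dotp y (slice_pt t z) =
  Num.sqrt (1 - t ^+ 2) * dotp (\row_j y 0 (lift ord0 j)) z + t * y 0 ord0.
Proof.
rewrite /dotp big_ord_recl mxE unlift_none addrC mulrC; congr (_ + _).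
rewrite mulr_sumr; apply: eq_bigr => i _.
by rewrite !mxE liftK mulrCA.
Qed.

Lemma dotp_recl d (y : 'rV[R]_d.+1) :
  dotp y y = y 0 ord0 ^+ 2 + dotp (\row_j y 0 (lift ord0 j)) (\row_j y 0 (lift ord0 j)).
Proof.
by rewrite /dotp big_ord_recl expr2; congr (_ + _); apply: eq_bigr => i _; rewrite !mxE.
Qed.

Lemma sphere_mom0_even k : sphere_mom 0 k.*2 = 1 :> R.
Proof.
elim: k => // k IHk; rewrite doubleS /= IHk mulr1 divff// pnatr_eq0.
Qed.

(* The total mass of the slice weight need not be shown nonzero: were it 0, then
   division by 0 would give c = 0. *)
Lemma sphere_int_zonal d : exists c : R, forall h (y : 'rV[R]_d.+1),
  sphere_int (fun z => h.[dotp y z]) = c * zonal_mean d h (dotp y y).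
Proof.
elim: d => [|d [c IHd]].
  exists 1 => h y; rewrite mul1r /= /dotp !big_ord_recl !big_ord0 !mxE !addr0 mulr1 mulrN1.
  rewrite !horner_coef -big_split/= mulr_suml /zonal_mean; apply: eq_bigr => k _.
  rewrite -mulrDr -mulrA; congr (_ * _).
  rewrite -expr2 -exprM mul2n.
  have := odd_double_half k; case: (boolP (odd k)) => [ko|ke] /= <-.
    rewrite sphere_mom_odd ?mul0r//=; last by rewrite odd_double.
    by rewrite exprNn -signr_odd /= odd_double /= expr1 mulN1r subrr mul0r.
  rewrite add0n sphere_mom0_even mul1r doubleK exprNn -signr_odd odd_double mul1r.
  by field.
pose Z := jmom 0 (slice_exp d) : R.
exists (c * Z /
  \int[lebesgue_measure]_(t in [set t : R | -1 <= t <= 1]) slice_weight d t) => h y.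
rewrite [LHS]/= mulrAC; congr (_ / _).
have -> : [set t : R | -1 <= t <= 1] = `[-1, 1]%classic.
  by apply/seteqP; split => t /=; rewrite in_itv/=.
pose rho := dotp (\row_j y 0 (lift ord0 j)) (\row_j y 0 (lift ord0 j)).
pose w k j : R := 'C(k, j)%:R * (y 0 ord0 ^+ (k - j) * (sphere_mom d j * rho ^+ j./2)).
pose G k (j : 'I_k.+1) (t : R) := t ^+ (k - j) * jacobi (slice_exp d + j./2%:R) t.
pose g k (t : R) := \sum_(j < k.+1) w k j * G k j t.
have jint n i : lebesgue_measure.-integrable `[-1, 1]
    (EFin \o (fun t : R => t ^+ n * jacobi (slice_exp d + i%:R) t)).
  apply: Xn_jacobi_integrable.
  by have := @slice_exp_gt R d; have : 0 <= i%:R :> R by []; lra.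
transitivity (\int[lebesgue_measure]_(t in `[-1, 1])
    \sum_(k < size h) (c * h`_k) * g k t).
  apply: eq_Rintegral => t; rewrite inE/= in_itv/= => t1.
  (* The restriction to the slice at height [t] is again zonal on the smaller sphere, so the
     induction hypothesis applies to the composed polynomial. *)
  have -> : (fun z => h.[dotp y (slice_pt t z)]) = (fun z =>
     (h \Po (Num.sqrt (1 - t ^+ 2) *: 'X + (t * y 0 ord0)%:P)).[
        dotp (\row_j y 0 (lift ord0 j)) z]).
    by apply/funext => z; rewrite horner_comp !hornerE dotp_slice_pt.
  rewrite IHd zonal_mean_affine mulrCA -/rho.
  under [in RHS]eq_bigr do rewrite -mulrA.
  rewrite -mulr_sumr; congr (_ * _).
  rewrite mulr_sumr; apply: eq_bigr => k _; rewrite mulrCA; congr (_ * _).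
  rewrite mulr_sumr; apply: eq_bigr => j _.
  (* Odd [j] contribute a zero moment; for even [j] the power of the square root is a power of
     1-t^2, which raises the Jacobi exponent by [j./2]. *)
  have [j_odd|j_even] := boolP (odd j).
    by rewrite /w sphere_mom_odd// !(mul0r, mulr0).
  have sj : Num.sqrt (1 - t ^+ 2) ^+ j = (1 - t ^+ 2) ^+ j./2.
    rewrite -[in LHS](odd_double_half j) (negPf j_even) add0n -mul2n exprM sqr_sqrtr//.
    exact: oneBsqr_ge0.
  rewrite /G jacobi_addn//; last exact: slice_exp_gt.
  rewrite sj /w exprMn /jacobi /slice_weight -/(slice_exp d); ring.
have gint k : lebesgue_measure.-integrable `[-1, 1] (EFin \o g k).
  by apply: (@Rintegral_lincomb R _ _ _ _ (G k) _ _).1 => // j; exact: jint.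
rewrite (@Rintegral_lincomb R _ _ _ _ (fun k : 'I_(size h) => g k) _ _).2//.
rewrite -mulrA /zonal_mean !mulr_sumr; apply: eq_bigr => k _; rewrite -!mulrA; congr (_ * _).
rewrite [RHS]mulrCA; congr (_ * _).
rewrite (@Rintegral_lincomb R _ _ _ _ (G k) _ _).2//; last by move=> j; exact: jint.
rewrite dotp_recl -/rho -slice_moment; apply: eq_bigr => j _.
by rewrite /w.
Qed.

Definition zonal_mpoly d (y : 'rV[R]_d.+1) k : mpoly.mpoly d.+1 R :=
  (\sum_(i < d.+1) y 0 i *: mpoly.mpolyX R (mpoly.mnm1 i)) ^+ k.

Lemma zonal_mpoly_deg d (y : 'rV[R]_d.+1) k : poly_deg_le (zonal_mpoly y k) k.
Proof.
have h1 : (\sum_(i < d.+1) y 0 i *: mpoly.mpolyX R (mpoly.mnm1 i)) \is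
    mpoly.ishomog1 1 (mpoly.Measure.clone d.+1 (@mpoly.mdeg d.+1) _).
  apply: rpred_sum => i _; apply: mpoly.dhomogZ.
  by rewrite mpoly.dhomogX /= mpoly.mdeg1.
have := mpoly.dhomogMn k h1; rewrite mul1n => /mpoly.dhomogP hk.
by apply/allP => mm /hk /= ->.
Qed.

Lemma poly_eval_zonal_mpoly d (y z : 'rV[R]_d.+1) k :
  poly_eval (zonal_mpoly y k) z = dotp y z ^+ k.
Proof.
rewrite /poly_eval /zonal_mpoly rmorphXn/= raddf_sum/=; congr (_ ^+ _).
by apply: eq_bigr => i _; rewrite mpoly.mevalZ mpoly.mevalXU.
Qed.

(** For each power k <= n the design property turns the sum of (y.x_i)^k into a sphere integral
    depending only on |y|^2. Linearity in [h] is used on the finite sums only. *)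
Lemma design_zonal_sum d N (x : 'I_N -> 'rV[R]_d.+1) n h (y z : 'rV[R]_d.+1) :
  spherical_design x n -> (size h <= n.+1)%N -> dotp y y = dotp z z ->
  \sum_(i < N) h.[dotp y (x i)] = \sum_(i < N) h.[dotp z (x i)].
Proof.
(* The empty family is set apart because multiplying by [N%:R] undoes [N%:R^-1] only for nonzero
   [N]. *)
case: N x => [|N] x dx hn yz; first by rewrite !big_ord0.
have [c sz] := sphere_int_zonal d.
have mom u k : (k <= n)%N ->
    \sum_(i < N.+1) dotp u (x i) ^+ k = N.+1%:R * (c * zonal_mean d 'X^k (dotp u u)).
  move=> kn; rewrite -sz.
  have -> : (fun z => ('X^k).[dotp u z]) = poly_eval (zonal_mpoly u k).
    by apply/funext => v; rewrite hornerXn poly_eval_zonal_mpoly.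
  rewrite -dx; last first.
    apply: sub_all (zonal_mpoly_deg u k) => mm /leq_trans; exact.
  rewrite mulrA divff ?mul1r ?pnatr_eq0//.
  by apply: eq_bigr => i _; rewrite poly_eval_zonal_mpoly.
have exp u : \sum_(i < N.+1) h.[dotp u (x i)] =
    \sum_(k < size h) h`_k * (N.+1%:R * (c * zonal_mean d 'X^k (dotp u u))).
  under eq_bigr do rewrite horner_coef.
  rewrite exchange_big/=; apply: eq_bigr => k _.
  rewrite -mulr_sumr mom//.
  by rewrite -ltnS (leq_trans (ltn_ord k)).
by rewrite !exp yz.
Qed.
End SphereZonal.

(** * Hermite interpolation and Rolle counting *)

Section HermiteError.
Context {R : realType}.
Implicit Types (g f : R -> R) (s tau : seq R).

(** Rolle between consecutive nodes. The zeros of the derivative lie strictly between neighbours,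
    hence avoid the nodes and can later be joined to the double nodes. *)
Lemma rolle_path g dg (x : R) s :
  path <%R x s ->
  (forall u v, u \in x :: s -> v \in x :: s -> u < v ->
     {within `[u, v], continuous g} /\
     forall t, u < t < v -> is_derive t 1 g (dg t)) ->
  {in x :: s, forall v, g v = 0} ->
  exists t, [/\ uniq t, size t = size s,
    {in t, forall v, x < v < last x s},
    {in t, forall v, dg v = 0} & {in t, forall v, v \notin x :: s}].
Proof.
elim: s x => [|y s IHs] x; first by exists [::].
move=> /= /andP[xy ys] gd g0.
have [||t [ut st tin td tn]] := IHs y ys.
- by move=> u v uin vin; apply: gd; rewrite inE ?uin ?vin orbT.
- by move=> v vin; apply: g0; rewrite inE vin orbT.
have [|||gc gder] := gd x y; rewrite ?inE ?eqxx ?orbT//.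
have gxy : g x = g y by rewrite !g0 ?inE ?eqxx ?orbT.
have yl : y <= last y s.
  have [/= -> //|ls] := eqVneq s [::].
  have ly : last y s \in s.
    by case: s ls {IHs ys gd g0 st tin tn} => //= a s _; exact: mem_last.
  by apply: ltW; apply: (allP (order_path_min lt_trans ys)).
have [|c cxy [dc dgc]] := @Rolle R g x y xy _ gc gxy.
  by move=> v; rewrite in_itv/= => /gder [].
move: cxy; rewrite in_itv/= => cxy; have [_ dc0] := gder c cxy.
move: (cxy) => /andP[xc cy].
exists (c :: t); split => /=.
- rewrite ut andbT; apply/negP => /tin /andP[yc _].
  by move: (lt_trans cy yc); rewrite ltxx.
- by rewrite st.
- move=> v; rewrite inE => /predU1P[->|/tin /andP[yv ->]].
    by rewrite xc (lt_le_trans cy).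
  by rewrite (lt_trans xy yv).
- by move=> v; rewrite inE => /predU1P[->|/td//]; rewrite -dc0 dgc.
- move=> v; rewrite inE => /predU1P[->|vt]; rewrite inE negb_or.
    rewrite gt_eqF//= inE negb_or lt_eqF//=.
    apply/negP => /(allP (order_path_min lt_trans ys)) /(lt_trans cy).
    by rewrite ltxx.
  rewrite tn// andbT gt_eqF//.
  by have /andP[yv _] := tin v vt; exact: lt_trans yv.
Qed.

(** Sorting reduces this to [rolle_path]. Derivability is asked only strictly between nodes, so 0
    and 4, where [f] is only assumed continuous, can serve as nodes. *)
Lemma rolle_seq g dg a b s : uniq s -> {in s, forall v, a <= v <= b} ->
  (forall u v, a <= u -> v <= b -> u \in s -> v \in s -> u < v ->
     {within `[u, v], continuous g} /\
     forall t, u < t < v -> is_derive t 1 g (dg t)) ->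
  {in s, forall v, g v = 0} ->
  exists t, [/\ uniq t, size t = (size s).-1,
    {in t, forall v, a < v < b},
    {in t, forall v, dg v = 0} & {in t, forall v, v \notin s}].
Proof.
move=> us sab gd g0.
have ss : sorted <%R (sort <=%R s) by rewrite sort_lt_sorted.
have ms : sort <=%R s =i s by move=> v; rewrite mem_sort.
have <- : size (sort <=%R s) = size s by rewrite size_sort.
case: (sort <=%R s) ss ms => [_ _|x p /= xp ms]; first by exists [::].
have [||t [ut st tin td tn]] := rolle_path (g := g) (dg := dg) xp.
- move=> u v; rewrite !ms => us' vs' uv; apply: gd => //.
    by have /andP[] := sab u us'.
  by have /andP[] := sab v vs'.
- by move=> v; rewrite ms; exact: g0.
exists t; split=> // v vt; last by rewrite -ms tn.
have /andP[xv vl] := tin v vt.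
have /andP[ax _] : a <= x <= b by apply: sab; rewrite -ms mem_head.
have /andP[_ lb] : a <= last x p <= b by apply: sab; rewrite -ms mem_last.
by rewrite (le_lt_trans ax xv) (lt_le_trans vl lb).
Qed.

Lemma rolle_iter (G : nat -> R -> R) (a b : R) k n s :
  (forall i (t : R), (k <= i < k + n)%N -> a < t < b -> is_derive t 1 (G i) (G i.+1 t)) ->
  uniq s -> {in s, forall v, a < v < b} -> {in s, forall v, G k v = 0} ->
  exists t, [/\ uniq t, size t = (size s - n)%N,
    {in t, forall v, a < v < b} & {in t, forall v, G (k + n)%N v = 0}].
Proof.
elim: n => [|n IHn] GD us sab s0.
  by exists s; rewrite addn0 subn0.
have [|//|//|//|t [ut st tab t0]] := IHn.
  by move=> i t /andP[ki ikn]; apply: GD; rewrite ki addnS ltnW.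
have dG v : a < v < b -> is_derive v 1 (G (k + n)%N) (G (k + n).+1 v).
  by move=> vab; apply: GD => //; rewrite leq_addr addnS ltnSn.
have [||t' [ut' st' tab' t0' _]] :=
    @rolle_seq (G (k + n)%N) (G (k + n).+1) a b t ut _ _ t0.
- by move=> v /tab /andP[/ltW -> /ltW ->].
- move=> u v au vb ut1 vt1 uv.
  have /andP[au' _] := tab u ut1; have /andP[_ vb'] := tab v vt1.
  split; last first.
    by move=> w /andP[uw wv]; apply: dG; rewrite (lt_trans au' uw) (lt_trans wv vb').
  apply: derivable_within_continuous => w; rewrite in_itv/= => /andP[uw wv].
  by have [] := dG w; rewrite ?(lt_le_trans au' uw) ?(le_lt_trans wv vb').
by exists t'; rewrite addnS; split; rewrite // st' st subnS.
Qed.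

Lemma strictly_convex_no_zero_between g (D : set R) a b c :
  strictly_convex_on D g -> D a -> D c -> a < b < c ->
  g a = 0 -> g c = 0 -> g b <> 0.
Proof.
move=> sc Da Dc /andP[ab bc] ga gc gb.
have ac : 0 < c - a by lra.
have := sc a c ((c - b) / (c - a)) Da Dc.
have -> : (c - b) / (c - a) * a + (1 - (c - b) / (c - a)) * c = b by field; lra.
rewrite ga gc gb !mulr0 addr0 ltxx => h; suff: false by [].
apply: h; first by rewrite lt_eqF//; lra.
by rewrite divr_gt0 ?ltr_pdivrMr//; lra.
Qed.

(** The value at the midpoint of c-e and c+e is strictly below the mean of two values that do not
    exceed it. *)
Lemma strictly_convex_no_interior_max g a b c :
  strictly_convex_on [set t | a < t < b] g -> a < c < b ->
  ~ (forall v, a < v < b -> g v <= g c).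
Proof.
move=> sc /andP[ac cb] gmax.
have [e [e0 ea eb]] : exists e, [/\ 0 < e, e < c - a & e < b - c].
  have m1 : Num.min (c - a) (b - c) <= c - a by rewrite ge_min lexx.
  have m2 : Num.min (c - a) (b - c) <= b - c by rewrite ge_min lexx orbT.
  have m0 : 0 < Num.min (c - a) (b - c) by rewrite lt_min !subr_gt0 ac cb.
  by exists (Num.min (c - a) (b - c) / 2); split; lra.
have l1 : a < c - e < b by apply/andP; split; lra.
have l2 : a < c + e < b by apply/andP; split; lra.
have := sc (c - e) (c + e) 2^-1 l1 l2.
have -> : 2^-1 * (c - e) + (1 - 2^-1) * (c + e) = c by field.
have := gmax _ l1; have := gmax _ l2 => g2 g1 h.
have : g c < 2^-1 * g (c - e) + (1 - 2^-1) * g (c + e).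
  by apply: h; [rewrite lt_eqF//; lra|apply/andP; split; lra].
lra.
Qed.
End HermiteError.

(** * Zero counting for the interpolation error and existence of the interpolant *)

Section HermiteInterpolation.
Context {R : realType}.
Implicit Types (f : R -> R) (tau : seq R) (P Q H : {poly R}).

(** For degree at most 2 the gap to the chord comes from the quadratic coefficient alone, whose sign
    therefore decides convexity. *)
Lemma horner_convex_comb Q (a b t : R) : (size Q <= 3)%N ->
  Q.[t * a + (1 - t) * b] =
  t * Q.[a] + (1 - t) * Q.[b] - t * (1 - t) * (a - b) ^+ 2 * Q`_2.
Proof.
by move=> Q3; rewrite !(horner_coef_wide _ Q3) !big_ord_recl !big_ord0 /bump /=; ring.
Qed.

Lemma size_derivn P n : (size P^`(n) <= size P - n)%N.
Proof.
apply/leq_sizeP => j jn; by rewrite coef_derivn nth_default ?mul0rn// -leq_subLR.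
Qed.

Definition hermite_data f tau P :=
  [/\ f 0 = P.[0], f 4 = P.[4], {in tau, forall v, f v = P.[v]} &
      {in tau, forall v, derive1n 1 f v = P^`().[v]}].

(** With q double nodes, f - P has q+3 zeros and its derivative 2q+2. Further Rolle steps give the
    derivative of order 2q three zeros in (0, 4), impossible under strict convexity. *)
Lemma no_extra_zero f tau P (u : R) :
  {within `[0, 4], continuous f} ->
  (forall k, (k < maxn (size tau).*2 1)%N ->
     forall t : R, 0 < t < 4 -> derivable (derive1n k f) t 1) ->
  uniq tau -> {in tau, forall v : R, 0 < v < 4} ->
  0 < u < 4 -> u \notin tau ->
  hermite_data f tau P -> f u = P.[u] ->
  ~ strictly_convex_on open04
     (fun t => derive1n (size tau).*2 f t - P^`((size tau).*2).[t]).
Proof.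
move=> cf df utau tau04 u04 unt [f0 f4 ftau f'tau] fu sc.
pose G k t : R := derive1n k f t - P^`(k).[t].
have GD k (t : R) : (k < maxn (size tau).*2 1)%N -> 0 < t < 4 ->
    is_derive t 1 (G k) (G k.+1 t).
  move=> kq t04; have d1 := derivableP (df k kq t t04).
  have d2 := is_derive_poly P^`(k) t.
  have := is_deriveB d1 d2; rewrite -derivnS => h; apply: (is_derive_eq h).
  by rewrite /G derive1nS derive1E.
have cG : {within `[0, 4], continuous (G 0%N)}.
  move=> t; apply: continuousB; first exact: cf.
  by apply: continuous_subspaceT; exact: continuous_horner.
have G00 : G 0%N 0 = 0 by rewrite /G derive1n0 derivn0 f0 subrr.
have G04 : G 0%N 4 = 0 by rewrite /G derive1n0 derivn0 f4 subrr.
have G0u : G 0%N u = 0 by rewrite /G derive1n0 derivn0 fu subrr.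
have /andP[u0 u4] := u04.
(* With no double node, f - P is itself strictly convex, but only on the open interval, so the zeros
   0 and 4 are out of reach. Its maximum on [0, 4] is used instead: if it sits at an endpoint its
   value is 0, which is also attained at [u]. *)
have [q0|q0] := posnP (size tau).
  rewrite q0 in sc.
  have [c c04 cmax] := EVT_max (ler0n R 4) cG.
  have [w w04 wmax] : exists2 w : R, 0 < w < 4 &
      forall v : R, 0 < v < 4 -> G 0%N v <= G 0%N w.
    have [c_in|c_out] := boolP (0 < c < 4).
      by exists c => // v /andP[? ?]; apply: cmax; rewrite in_itv/= !ltW.
    exists u => // v /andP[? ?]; rewrite G0u.
    have <- : G 0%N c = 0.
      move: c04 c_out; rewrite in_itv/= => /andP[c0 c4].
      rewrite negb_and -!leNgt => /orP[c0'|c4'].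
        by have -> : c = 0 by apply/eqP; rewrite eq_le c0 c0'.
      by have -> : c = 4 by apply/eqP; rewrite eq_le c4 c4'.
    by apply: cmax; rewrite in_itv/= !ltW.
  exact: (strictly_convex_no_interior_max sc w04 wmax).
pose s0 := [:: 0, 4, u & tau].
have us0 : uniq s0.
  rewrite /s0 /= !inE !negb_or utau unt.
  have n0 : 0 \notin tau by apply/negP => /tau04; rewrite ltxx.
  have n4 : 4 \notin tau by apply/negP => /tau04; rewrite ltxx andbF.
  by rewrite n0 n4 (lt_eqF u0) (gt_eqF u4) lt_eqF.
have [|||t0 [ut0 st0 t04 G1t0 t0s]] := @rolle_seq R (G 0%N) (G 1%N) 0 4 s0 us0.
- move=> v; rewrite !inE => /or4P[/eqP->|/eqP->|/eqP->|/tau04 /andP[/ltW -> /ltW ->]]//.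
  + by rewrite lexx ler0n.
  + by rewrite lexx ler0n.
  + by rewrite !ltW.
- have s04 (v : R) : v \in s0 -> 0 <= v <= 4.
    rewrite !inE => /or4P[/eqP->|/eqP->|/eqP->|/tau04 /andP[/ltW -> /ltW ->]]//.
    + by rewrite lexx ler0n.
    + by rewrite lexx ler0n.
    + by rewrite !ltW.
  move=> v w _ _ /s04 /andP[v0 _] /s04 /andP[_ w4] vw; split.
    apply: continuous_subspaceW cG => t /=; rewrite !in_itv/= => /andP[vt tw].
    by rewrite (le_trans v0 vt) (le_trans tw w4).
  move=> t /andP[vt tw]; apply: GD; first by rewrite leq_max orbT.
  by rewrite (le_lt_trans v0 vt) (lt_le_trans tw w4).
- move=> v; rewrite !inE => /or4P[/eqP->|/eqP->|/eqP->|vtau]//.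
  by rewrite /G derive1n0 derivn0 /= ftau// subrr.
(* The q+2 Rolle points avoid [tau], so with [tau] they form 2q+2 distinct zeros of [G 1]; the 2q-1
   remaining derivations leave 3. *)
have [||||t [ut st t04' t0G]] :=
  @rolle_iter R G 0 4 1 (size tau).*2.-1 (t0 ++ tau) _ _ _ _.
- move=> i t /andP[i1 i2] t04'; apply: GD => //; rewrite leq_max; lia.
- rewrite cat_uniq ut0 utau andbT /=; apply/hasPn => v vtau /=.
  by apply/negP => /t0s; rewrite !inE vtau !orbT.
- by move=> v; rewrite mem_cat => /orP[/t04|/tau04].
- move=> v; rewrite mem_cat => /orP[/G1t0//|vtau].
  by rewrite /G derivn1 f'tau// subrr.
have sz3 : size t = 3 by rewrite st size_cat st0 /=; lia.
have e1 : (1 + (size tau).*2.-1 = (size tau).*2)%N by lia.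
rewrite e1 in t0G.
have st3 : sorted <%R (sort <=%R t) by rewrite sort_lt_sorted.
have : size (sort <=%R t) = 3 by rewrite size_sort.
have : {subset sort <=%R t <= t} by move=> v; rewrite mem_sort.
move: st3; case: (sort <=%R t) => [|x1 [|x2 [|x3 [|]]]]//= /and3P[x12 x23 _] sub _.
have i1 : x1 \in t by apply: sub; rewrite !inE eqxx.
have i2 : x2 \in t by apply: sub; rewrite !inE eqxx orbT.
have i3 : x3 \in t by apply: sub; rewrite !inE eqxx !orbT.
apply: (@strictly_convex_no_zero_between R (G (size tau).*2) open04 x1 x2 x3 sc).
- exact: t04'.
- exact: t04'.
- by rewrite x12 x23.
- exact: t0G.
- exact: t0G.
- exact: t0G.
Qed.

Definition node_sqr tau : {poly R} := (\prod_(v <- tau) ('X - v%:P)) ^+ 2.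

Lemma node_sqr_monic tau : node_sqr tau \is monic.
Proof. by rewrite rpredX// monic_prod_XsubC. Qed.

Lemma size_node_sqr tau : size (node_sqr tau) = (size tau).*2.+1.
Proof.
rewrite /node_sqr expr2 size_monicM ?monic_neq0 ?monic_prod_XsubC// size_prod_XsubC.
by rewrite addnS addSn addnn.
Qed.

Lemma node_sqr_ge0 tau u : 0 <= (node_sqr tau).[u].
Proof. by rewrite /node_sqr horner_exp sqr_ge0. Qed.

Lemma node_sqr_eq0 tau u : ((node_sqr tau).[u] == 0) = (u \in tau).
Proof. by rewrite /node_sqr horner_exp expf_eq0/= -/(root _ _) root_prod_XsubC. Qed.

Lemma node_sqr_deriv tau u : u \in tau -> (node_sqr tau)^`().[u] = 0.
Proof.
rewrite -node_sqr_eq0 /node_sqr horner_exp expf_eq0/= => /eqP e.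
by rewrite expr2 derivM hornerD !hornerM e mulr0 mul0r addr0.
Qed.

(** Newton's scheme: the correction (c0 + c1 (X - v)) W, with W the squared nodal polynomial of the
    earlier nodes, leaves the earlier data intact, and W(v) <> 0 lets c0 and c1 adjust the value and
    the derivative at v. *)
Lemma hermite_exists_deriv (a b : R -> R) tau : uniq tau ->
  exists H : {poly R}, [/\ (size H <= (size tau).*2)%N,
    {in tau, forall v, H.[v] = a v} & {in tau, forall v, H^`().[v] = b v}].
Proof.
elim: tau => [|v tau IHtau]; first by exists 0; rewrite size_poly0.
move=> /= /andP[vt /IHtau [H [sH Ha Hb]]].
have [W [sW W0 dW]] : exists W : {poly R}, [/\ size W = (size tau).*2.+1,
    forall u, (W.[u] == 0) = (u \in tau) & forall u, u \in tau -> W^`().[u] = 0].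
  exists (node_sqr tau); split; first exact: size_node_sqr.
    exact: node_sqr_eq0.
  exact: node_sqr_deriv.
have n0 : W.[v] != 0 by rewrite W0.
pose c0 := (a v - H.[v]) / W.[v].
pose c1 := (b v - H^`().[v] - c0 * W^`().[v]) / W.[v].
exists (H + (c0%:P + c1 *: ('X - v%:P)) * W); split.
- rewrite (leq_trans (size_polyD _ _))// geq_max (leq_trans sH)//=; last by rewrite leq_double.
  rewrite (leq_trans (size_polyMleq _ _))// sW addnS /=.
  have : (size (c0%:P + c1 *: ('X - v%:P))%R <= 2)%N.
    rewrite (leq_trans (size_polyD _ _))// geq_max.
    rewrite (leq_trans (size_scale_leq _ _)) ?size_XsubC//.
    by rewrite (leq_trans (size_polyC_leq1 _)).
  by rewrite doubleS -[_.*2.+2]add2n leq_add2r.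
- move=> w; rewrite inE => /predU1P[->|wt].
    rewrite /c1 /c0.
    by rewrite !hornerE subrr mulr0 addr0; field.
  by rewrite hornerD hornerM (eqP (_ : W.[w] == 0)) ?W0// mulr0 addr0 Ha.
- move=> w; rewrite inE !(derivXsubC, derivM, derivC, derivZ, derivD) => /predU1P[->|wt].
    rewrite /c1 /c0.
    by rewrite !(hornerXsubC, hornerM, hornerC, hornerZ, hornerD); field.
  rewrite !hornerD !hornerM (eqP (_ : W.[w] == 0)) ?W0//.
  by rewrite dW// !mulr0 !addr0 Hb.
Qed.

(** A linear factor times W, chosen by its values [c0] at 0 and [c4] at 4, corrects the two endpoint
    values without disturbing the data on [tau]. *)
Lemma hermite_exists f tau : uniq tau -> {in tau, forall v : R, 0 < v < 4} ->
  exists2 H : {poly R}, (size H <= (size tau).*2.+2)%N & hermite_data f tau H.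
Proof.
move=> utau tau04.
have [H [sH Ha Hb]] := hermite_exists_deriv f (derive1n 1 f) utau.
have [W [sW W0 dW]] : exists W : {poly R}, [/\ size W = (size tau).*2.+1,
    forall u, (W.[u] == 0) = (u \in tau) & forall u, u \in tau -> W^`().[u] = 0].
  exists (node_sqr tau); split; first exact: size_node_sqr.
    exact: node_sqr_eq0.
  exact: node_sqr_deriv.
have n0 : W.[0] != 0.
  by rewrite W0; apply/negP => /tau04; rewrite ltxx.
have n4 : W.[4] != 0.
  by rewrite W0; apply/negP => /tau04; rewrite ltxx andbF.
pose c0 := (f 0 - H.[0]) / W.[0].
pose c4 := (f 4 - H.[4]) / W.[4].
exists (H + (c0%:P + ((c4 - c0) / 4) *: 'X) * W).
  rewrite (leq_trans (size_polyD _ _))// geq_max (leq_trans sH)//=; last exact/leqW/leqnSn.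
  rewrite (leq_trans (size_polyMleq _ _))// sW addnS /=.
  have : (size (c0%:P + ((c4 - c0) / 4) *: 'X)%R <= 2)%N.
    rewrite (leq_trans (size_polyD _ _))// geq_max.
    rewrite (leq_trans (size_scale_leq _ _)) ?size_polyX//.
    by rewrite (leq_trans (size_polyC_leq1 _)).
  by rewrite -[_.*2.+2]add2n leq_add2r.
split.
- rewrite /c4 /c0.
  by rewrite !hornerE; field.
- rewrite /c4 /c0.
  by rewrite !hornerE; field; rewrite n0.
- move=> w wt.
  by rewrite hornerD hornerM (eqP (_ : W.[w] == 0)) ?W0// mulr0 addr0 Ha.
- move=> w wt; rewrite !(derivD, derivM, derivC, derivZ, derivX).
  rewrite !hornerD !hornerM (eqP (_ : W.[w] == 0)) ?W0//.
  by rewrite dW// !mulr0 !addr0 Hb.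
Qed.
End HermiteInterpolation.

(** * Sign of the Hermite interpolation error *)

Section HermiteErrorSign.
Context {R : realType}.
Variables (f : R -> R) (tau : seq R) (H : {poly R}).
Hypothesis cf : {within `[0, 4], continuous f}.
Hypothesis df : forall k, (k < maxn (size tau).*2 1)%N ->
  forall t : R, 0 < t < 4 -> derivable (derive1n k f) t 1.
Hypothesis utau : uniq tau.
Hypothesis tau04 : {in tau, forall v : R, 0 < v < 4}.
Hypothesis sizeH : (size H <= (size tau).*2.+2)%N.
Hypothesis fH : hermite_data f tau H.

Let n := (size tau).*2.

Definition node_poly (tau : seq R) : {poly R} := 'X * ('X - 4%:P) * node_sqr tau.

Lemma node_poly_monic : node_poly tau \is monic.
Proof.
by rewrite /node_poly monicMr ?node_sqr_monic// monicMr ?monicXsubC// monicX.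
Qed.

Lemma size_node_poly : size (node_poly tau) = n.+3.
Proof.
have mX : 'X * ('X - 4%:P) \is @monic R by rewrite monicMr ?monicXsubC// monicX.
rewrite /node_poly size_monicM ?monic_neq0 ?node_sqr_monic//.
rewrite size_node_sqr size_monicM ?monicX ?polyXsubC_eq0// size_polyX size_XsubC.
by rewrite !addSn.
Qed.

Lemma node_poly_lt0 u : 0 < u < 4 -> u \notin tau -> (node_poly tau).[u] < 0.
Proof.
move=> /andP[u0 u4] ut; rewrite /node_poly 2!hornerM hornerXsubC hornerX.
rewrite pmulr_llt0 ?pmulr_rlt0 ?subr_lt0//.
by rewrite lt_neqAle eq_sym node_sqr_eq0 ut node_sqr_ge0.
Qed.

Lemma hermite_data_add (c : R) : hermite_data f tau (H + c *: node_poly tau).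
Proof.
have [f0 f4 ftau dftau] := fH.
have h0 : (node_poly tau).[0] = 0 by rewrite /node_poly 2!hornerM hornerX !mul0r.
have h4 : (node_poly tau).[4] = 0.
  by rewrite /node_poly 2!hornerM hornerXsubC subrr mulr0 mul0r.
have ht v : v \in tau -> (node_poly tau).[v] = 0.
  by rewrite -node_sqr_eq0 => /eqP e; rewrite /node_poly hornerM e mulr0.
have hdt v : v \in tau -> (node_poly tau)^`().[v] = 0.
  move=> vt; have := vt; rewrite -node_sqr_eq0 => /eqP e.
  rewrite /node_poly; move: (node_sqr tau) e (node_sqr_deriv vt) => W e dW.
  by rewrite derivM hornerD !hornerM e dW !mulr0 addr0.
split.
- by rewrite hornerD hornerZ h0 mulr0 addr0.
- by rewrite hornerD hornerZ h4 mulr0 addr0.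
- by move=> v vt; rewrite hornerD hornerZ ht// mulr0 addr0 ftau.
- by move=> v vt; rewrite derivD derivZ hornerD hornerZ hdt// mulr0 addr0 dftau.
Qed.

(** As H has degree at most n+1, the n-th derivative of the modified interpolant is a quadratic
    whose leading coefficient has the sign of [c]. Subtracting it preserves strict convexity for c
    <= 0 and creates it for c < 0. *)
Lemma strictly_convex_sub (c : R) :
  (c < 0 /\ convex_on open04 (derive1n n f)) \/
  (c <= 0 /\ strictly_convex_on open04 (derive1n n f)) ->
  strictly_convex_on open04
    (fun t => derive1n n f t - (H + c *: node_poly tau)^`(n).[t]).
Proof.
set Q := (_ + _)^`(n).
have sQ : (size Q <= 3)%N.
  rewrite (leq_trans (size_derivn _ _))// leq_subLR addn3.
  rewrite (leq_trans (size_polyD _ _))// geq_max (leq_trans sizeH) ?leqnSn//=.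
  by rewrite (leq_trans (size_scale_leq _ _))// size_node_poly.
have Q2 : Q`_2 = c * ((n + 2) ^_ n)%:R.
  rewrite /Q coef_derivn coefD coefZ nth_default ?add0r; last by rewrite addn2.
  have := node_poly_monic; rewrite monicE lead_coefE size_node_poly /= addn2 => /eqP ->.
  by rewrite mulr1 mulr_natr.
have K0 : 0 < ((n + 2) ^_ n)%:R :> R by rewrite ltr0n ffact_gt0 leq_addr.
move=> hyp a b t Da Db ab /andP[t0 t1].
rewrite horner_convex_comb// Q2.
have ab2 : 0 < (a - b) ^+ 2 by rewrite exprn_even_gt0//= subr_eq0.
have p0 : 0 < t * (1 - t) * (a - b) ^+ 2 * ((n + 2) ^_ n)%:R.
  by do 3?[apply: mulr_gt0 => //]; rewrite subr_gt0.
have -> : t * (1 - t) * (a - b) ^+ 2 * (c * ((n + 2) ^_ n)%:R) =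
    c * (t * (1 - t) * (a - b) ^+ 2 * ((n + 2) ^_ n)%:R) by ring.
case: hyp => -[c0 cv].
  have t01 : 0 <= t <= 1 by rewrite !ltW.
  have := cv a b t Da Db t01; move: c0; rewrite -(pmulr_llt0 _ p0).
  lra.
have t01 : 0 < t < 1 by rewrite t0 t1.
have := cv a b t Da Db ab t01; move: c0; rewrite -(pmulr_lle0 _ p0).
lra.
Qed.

(** The multiple [c] of the nodal polynomial is chosen so that the modified interpolant also meets
    [f] at [u]. The nodal polynomial is negative there, so [c] is nonpositive, and negative if f(u)
    > H(u); the extra zero then contradicts [no_extra_zero]. *)
Lemma hermite_no_crossing (u : R) : 0 < u < 4 -> u \notin tau -> H.[u] <= f u ->
  (H.[u] < f u /\ convex_on open04 (derive1n n f)) \/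
  strictly_convex_on open04 (derive1n n f) -> False.
Proof.
move=> u04 ut Hu hyp; have om0 := node_poly_lt0 u04 ut.
pose c := (f u - H.[u]) / (node_poly tau).[u].
apply: (no_extra_zero cf df utau tau04 u04 ut (hermite_data_add c)).
  by rewrite hornerD hornerZ /c divfK ?lt_eqF// addrC subrK.
apply: strictly_convex_sub; case: hyp => [[Hu' cv]|sc]; [left|right]; split => //.
  by rewrite /c pmulr_rlt0 ?subr_gt0// invr_lt0.
by rewrite /c mulr_ge0_le0 ?subr_ge0// invr_le0 ltW.
Qed.

Lemma hermite_ge (u : R) : convex_on open04 (derive1n n f) -> 0 <= u <= 4 ->
  f u <= H.[u].
Proof.
move=> cv /andP[u0 u4]; have [f0 f4 ftau _] := fH.
have [->|un0] := eqVneq u 0; first by rewrite f0.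
have [->|un4] := eqVneq u 4; first by rewrite f4.
have [ut|ut] := boolP (u \in tau); first by rewrite ftau.
rewrite leNgt; apply/negP => Hu.
apply: (@hermite_no_crossing u) => //; last by left.
  by rewrite !lt_neqAle eq_sym un0 un4 u0 u4.
exact: ltW.
Qed.

Lemma hermite_eq (u : R) : strictly_convex_on open04 (derive1n n f) -> 0 <= u <= 4 ->
  f u = H.[u] -> [\/ u = 0, u = 4 | u \in tau].
Proof.
move=> sc /andP[u0 u4] fu.
have [->|un0] := eqVneq u 0; first by constructor 1.
have [->|un4] := eqVneq u 4; first by constructor 2.
have [ut|ut] := boolP (u \in tau); first by constructor 3.
exfalso; apply: (@hermite_no_crossing u) => //; last by right.
  by rewrite !lt_neqAle eq_sym un0 un4 u0 u4.
by rewrite fu.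
Qed.
End HermiteErrorSign.

(** * Sharp antipodal configurations *)

Section SphereDistances.
Context {R : realType} (d : nat).
Implicit Types (x y : 'rV[R]_d.+1).

Lemma dotpC x y : dotp x y = dotp y x.
Proof. by apply: eq_bigr => i _; rewrite mulrC. Qed.

Lemma dotpN x y : dotp x (- y) = - dotp x y.
Proof. by rewrite /dotp -sumrN; apply: eq_bigr => i _; rewrite mxE mulrN. Qed.

Lemma dotp_ge0 x : 0 <= dotp x x.
Proof. by apply: sumr_ge0 => i _; rewrite -expr2 sqr_ge0. Qed.

Lemma dotp_eq0 x : dotp x x = 0 -> x = 0.
Proof.
move=> /eqP; rewrite psumr_eq0; last by move=> i _; rewrite -expr2 sqr_ge0.
move=> /allP h; apply/rowP => i; rewrite mxE.
by have := h i (mem_index_enum _); rewrite -expr2 sqrf_eq0 => /eqP.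
Qed.

Lemma sqdistE x y : on_sphere x -> on_sphere y -> sqdist x y = 2 - 2 * dotp x y.
Proof.
rewrite /on_sphere /sqdist => hx hy.
transitivity (dotp x x + dotp y y - 2 * dotp x y); last by rewrite hx hy; ring.
rewrite /dotp mulr_sumr -big_split/= -sumrB; apply: eq_bigr => i _.
by rewrite !mxE; ring.
Qed.

Lemma on_sphereN x : on_sphere x -> on_sphere (- x).
Proof. by rewrite /on_sphere dotpN dotpC dotpN opprK. Qed.

Lemma sqdist_ge0 x y : 0 <= sqdist x y.
Proof. exact: dotp_ge0. Qed.

Lemma sqdist_eq0 x y : sqdist x y = 0 -> x = y.
Proof. by move=> /dotp_eq0/eqP; rewrite subr_eq0 => /eqP. Qed.

Lemma sqdistN x y : on_sphere x -> on_sphere y -> sqdist x (- y) = 4 - sqdist x y.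
Proof.
move=> hx hy; rewrite !sqdistE//; last exact: on_sphereN.
by rewrite dotpN; ring.
Qed.

(** The upper bound is the nonnegativity of the squared distance to the antipode. *)
Lemma sqdist_bounds x y : on_sphere x -> on_sphere y -> 0 <= sqdist x y <= 4.
Proof.
move=> hx hy; rewrite sqdist_ge0/=.
by have := sqdist_ge0 x (- y); rewrite sqdistN//; lra.
Qed.

(** On the sphere the squared distance is 2 - 2 y.z, so composing with this affine map brings the
    claim back to inner products without raising the degree. *)
Lemma design_sqdist_sum N (x : 'I_N -> 'rV[R]_d.+1) n (h : {poly R}) y z :
  (forall i, on_sphere (x i)) -> spherical_design x n -> (size h <= n.+1)%N ->
  on_sphere y -> on_sphere z ->
  \sum_(i < N) h.[sqdist y (x i)] = \sum_(i < N) h.[sqdist z (x i)].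
Proof.
move=> hx dx hn hy hz; pose q := h \Po (2%:P - 2 *: 'X).
have sq : (size q <= n.+1)%N.
  have -> : q = h \Po ((- 2) *: 'X + 2%:P) by rewrite /q scaleNr addrC.
  rewrite (leq_trans (size_comp_poly_leq _ _))// ltnS.
  have : (size ((- 2 : R) *: 'X + 2%:P)%R <= 2)%N.
    rewrite (leq_trans (size_polyD _ _))// geq_max.
    rewrite (leq_trans (size_scale_leq _ _)) ?size_polyX//.
    by rewrite (leq_trans (size_polyC_leq1 _)).
  move: (size (_ *: 'X + _)%R) => [|[|[|]]]// _.
  - by rewrite muln0.
  - by rewrite muln0.
  - by rewrite muln1; case: (size h) hn.
have qE u i : on_sphere u -> q.[dotp u (x i)] = h.[sqdist u (x i)].
  move=> hu; rewrite /q horner_comp sqdistE//; congr (h.[_]).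
  by rewrite hornerD hornerN hornerZ hornerX hornerC.
transitivity (\sum_(i < N) q.[dotp y (x i)]).
  by apply: eq_bigr => i _; rewrite qE.
rewrite (design_zonal_sum (z := z) dx sq); last by rewrite hy hz.
by apply: eq_bigr => i _; rewrite qE.
Qed.
End SphereDistances.

(** Antipodality makes -1 one of the m inner products, corresponding to squared distance 4; the
    other m - 1 give squared distances strictly between 0 and 4. *)
Lemma sharp_nodes {R : realType} (m d N : nat) (x : 'I_N -> 'rV[R]_d.+1) :
  (1 <= m)%N -> antipodal x -> m_sharp m x ->
  exists tau : seq R, [/\ uniq tau, size tau = m.-1,
    {in tau, forall v : R, 0 < v < 4} &
    forall i j, [\/ sqdist (x i) (x j) = 0, sqdist (x i) (x j) = 4 |
                    sqdist (x i) (x j) \in tau]].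
Proof.
move=> m1 anti [[xinj xS] [_ [s [us [ss sP]]]]].
have neg1 : -1 \in s.
  have [a /sP[i [j [ij _]]]] : exists a, a \in s.
    by case: s ss {us sP} m1 => [<-//|a s _ _]; exists a; rewrite mem_head.
  have [k xk] := anti i; apply/sP; exists i, k; split; last by rewrite xk dotpN xS.
  move=> ik; rewrite -ik in xk; have := xS i.
  have : dotp (x i) (x i) = - dotp (x i) (x i) by rewrite -dotpN -xk.
  rewrite /on_sphere; lra.
exists [seq 2 - 2 * a | a <- rem (-1) s]; split.
- rewrite map_inj_uniq ?rem_uniq// => a b; lra.
- by rewrite size_map size_rem// ss.
- move=> v /mapP[a]; rewrite mem_rem_uniq// inE => /andP[an1 /sP[i [j [ij aE]]]] ->.
  have := sqdist_bounds (xS i) (xS j); rewrite sqdistE// aE => /andP[a0 a4].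
  apply/andP; split; rewrite lt_neqAle ?a0 ?a4 ?andbT.
    apply/eqP => e; apply: ij; apply: xinj; apply: sqdist_eq0.
    by rewrite sqdistE// aE.
  apply: contraNneq an1 => e; apply/eqP; lra.
- move=> i j; have [<-|ij] := eqVneq i j.
    by constructor 1; rewrite sqdistE// xS; ring.
  have ain : dotp (x i) (x j) \in s by apply/sP; exists i, j; split => //; exact/eqP.
  have [e|an1] := eqVneq (dotp (x i) (x j)) (-1).
    by constructor 2; rewrite sqdistE// e; ring.
  by constructor 3; rewrite sqdistE//; apply: map_f; rewrite mem_rem_uniq// inE an1.
Qed.

(** * Maxima of the potential *)

Unset Implicit Arguments.

Theorem theorem2p4 (R : realType) (m d N : nat) (f : R -> R)
  (x : 'I_N -> 'rV[R]_d.+1) :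
  (1 <= m)%N -> (1 <= d)%N ->
  {within [set t : R | 0 <= t <= 4], continuous f} ->
  (* f, f', ..., f^(2m-3) differentiable on (0,4); f differentiable in any case *)
  (forall k : nat, (k < maxn (2 * m - 2) 1)%N ->
     forall t : R, open04 t -> derivable (derive1n k f) t 1) ->
  convex_on open04 (derive1n (2 * m - 2) f) ->
  antipodal x -> m_sharp m x ->
  (forall j : 'I_N, forall y : 'rV[R]_d.+1, on_sphere y ->
     potential f x y <= potential f x (x j)) /\
  (strictly_convex_on open04 (derive1n (2 * m - 2) f) ->
   forall y : 'rV[R]_d.+1, on_sphere y ->
     (forall z : 'rV[R]_d.+1, on_sphere z -> potential f x z <= potential f x y) ->
     exists j : 'I_N, y = x j).
Proof.
move=> m1 d1 cf df cv anti sharp.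
have [[xinj xS] [dx _]] := sharp.
have [tau [utau stau tau04 tauP]] := sharp_nodes m1 anti sharp.
have en : (2 * m - 2 = (size tau).*2)%N by rewrite stau; lia.
rewrite en in df cv *.
have cf' : {within `[0, 4], continuous f}.
  have -> // : `[0, 4]%classic = [set t : R | 0 <= t <= 4].
  by apply/seteqP; split => t /=; rewrite in_itv/=.
have [H sH fH] := hermite_exists f utau tau04.
have fleH u : 0 <= u <= 4 -> f u <= H.[u] := hermite_ge cf' df utau tau04 sH fH cv.
have fH_nodes i j : f (sqdist (x i) (x j)) = H.[sqdist (x i) (x j)].
  by have [f0 f4 ftau _] := fH; case: (tauP i j) => [->|->|/ftau].
have Hsum y z : on_sphere y -> on_sphere z ->
    \sum_(i < N) H.[sqdist y (x i)] = \sum_(i < N) H.[sqdist z (x i)].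
  move=> hy hz; apply: (design_sqdist_sum xS dx) => //.
  by rewrite (leq_trans sH)// stau; lia.
(* At a point of the configuration every squared distance is a node, so [f] may be replaced by H,
   whose sum is constant on the sphere since deg H <= 2m - 1. *)
have potE j y : on_sphere y -> potential f x (x j) = \sum_(i < N) H.[sqdist y (x i)].
  by move=> hy; rewrite (Hsum _ (x j))//; apply: eq_bigr.
split=> [j y hy|sc y hy ymax].
  rewrite (potE j y hy); apply: ler_sum => i _.
  exact: fleH (sqdist_bounds hy (xS i)).
have N0 : (0 < N)%N.
  have [_ [_ [s [_ [ss sP]]]]] := sharp.
  case: s ss sP => [m0|a s _ sP]; first by rewrite -m0 in m1.
  have [i _] : exists i j : 'I_N, i <> j /\ dotp (x i) (x j) = a.
    by apply/sP; rewrite mem_head.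
  exact: leq_ltn_trans (leq0n i) (ltn_ord i).
pose j0 : 'I_N := Ordinal N0.
(* The terms H - f are nonnegative, and their sum is the potential at [x j0] minus that at the
   maximum point [y], hence at most 0; so each term vanishes. *)
have fHy i : f (sqdist y (x i)) = H.[sqdist y (x i)].
  apply/eqP; rewrite eq_sym -subr_eq0.
  have ge0 (k : 'I_N) : true -> 0 <= H.[sqdist y (x k)] - f (sqdist y (x k)).
    by move=> _; rewrite subr_ge0 fleH// sqdist_bounds.
  have : \sum_(k < N) (H.[sqdist y (x k)] - f (sqdist y (x k))) == 0.
    rewrite eq_le sumr_ge0 ?andbT// sumrB subr_le0 -(potE j0)//.
    exact: ymax (xS j0).
  by rewrite psumr_eq0// => /allP /(_ i (mem_index_enum _)).
have [/existsP[i yi]|/existsPn nyx] := boolP [exists i, y == x i].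
  by exists i; apply/eqP.
(* Squared distance 0 or 4 to [x i] would make [y] equal to [x i] or its antipode, both in the
   configuration. *)
have ytau i : sqdist y (x i) \in tau.
  case: (hermite_eq cf' df utau tau04 sH fH sc (sqdist_bounds hy (xS i)) (fHy i)) => // e.
    by have := nyx i; rewrite (sqdist_eq0 e) eqxx.
  have [k xk] := anti i; have := nyx k; rewrite xk.
  have -> : y = - x i by apply: sqdist_eq0; rewrite sqdistN// e subrr.
  by rewrite eqxx.
have Wsum : \sum_(i < N) (node_sqr tau).[sqdist y (x i)] =
            \sum_(i < N) (node_sqr tau).[sqdist (x j0) (x i)].
  apply: (design_sqdist_sum xS dx) => //; rewrite size_node_sqr stau; lia.
have : \sum_(i < N) (node_sqr tau).[sqdist (x j0) (x i)] == 0.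
  by rewrite -Wsum big1// => i _; apply/eqP; rewrite node_sqr_eq0.
(* The term of index [j0] is the value of [node_sqr tau] at 0; its vanishing would put 0 in
   [tau]. *)
rewrite psumr_eq0 => [/allP /(_ j0 (mem_index_enum _))|i _]; last exact: node_sqr_ge0.
rewrite /= node_sqr_eq0 sqdistE// xS => /tau04.
have -> : 2 - 2 * 1 = 0 :> R by ring.
by rewrite ltxx.
Qed.
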